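(* Let $R>0$, $\kappa>0$ and $B>0$ be constants. The relative error at $r=0$ of the New IDSA approximation $J_{\rm idsa}$ with respect to the exact homogeneous sphere solution $J$, namely ${\rm Err}_0=\frac{J(0)-J_{\rm idsa}(0)}{J(0)}$, is given by $${\rm Err}_0=\frac{\left(\frac{\sqrt3\kappa R}{\sinh(\sqrt3\kappa R)}-e^{-\kappa R}\right)}{\left(1-e^{-\kappa R}\right)}.$$
   Context: The exact stationary zeroth angular moment of the homogeneous sphere (radius $R$, opacity $\kappa$ for $r<R$ and $0$ for $r\ge R$, constant equilibrium distribution $B$) is, for $r<R$, $$J(r)=B\left[1-\int_0^1\cosh(\kappa r\mu)\,e^{-\kappa RG(r,\mu)}\,d\mu\right],\qquad G(r,\mu):=\left[1-\left(\frac rR\right)^2(1-\mu^2)\right]^{1/2}.$$ The New IDSA stationary approximation is $J_{\rm idsa}=J^t+J^s$ where, for $0<r<R$, $$J^t(r)=B\left(1-\frac Rr\,\frac{\sinh(\sqrt3\kappa r)}{\sinh(\sqrt3\kappa R)}\right),\qquad J^s(r)=C\,\frac{3\kappa^2BR}{\sinh(\sqrt3\kappa R)}\left(\frac{\sinh(\sqrt3\kappa r)}{(\sqrt3\kappa r)^2}-\frac{\cosh(\sqrt3\kappa r)}{\sqrt3\kappa r}\right),$$ $$C=\frac R2\left[1+\frac{e^{-2\kappa R}-1}{2\kappa R}\right]\left(1-\frac{\sqrt3\kappa R}{\tanh(\sqrt3\kappa R)}\right)^{-1}.$$ The value $J_{\rm idsa}(0)$ is the limit of $J_{\rm idsa}(r)$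 as $r\to0^+$. *)

(* Defs.v *)
From Stdlib Require Import Reals.
From Coquelicot Require Import Coquelicot.
Open Scope R_scope.

(** The radius of the sphere is written [Rs]
    ([R] being the type of real numbers), the opacity [kappa], and the
    equilibrium distribution [B]. *)

Definition hsG (Rs r mu : R) : R :=
  sqrt (1 - (r / Rs) ^ 2 * (1 - mu ^ 2)).

(** Exact stationary zeroth angular moment; meaningful for [0 <= r < Rs]. *)
Definition J_exact (Rs kappa B r : R) : R :=
  B * (1 - RInt (fun mu => cosh (kappa * r * mu)
                           * exp (- (kappa * Rs * hsG Rs r mu))) 0 1).

(** The New IDSA components; meaningful for [0 < r < Rs] only.  Since [/ 0] is
    an unspecified real, their values at [r = 0] must not be used: the value of
    the approximation there is a limit as [r] tends to [0] from the right. *)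
Definition J_trapped (Rs kappa B r : R) : R :=
  B * (1 - Rs / r * (sinh (sqrt 3 * kappa * r) / sinh (sqrt 3 * kappa * Rs))).

Definition idsa_C (Rs kappa : R) : R :=
  Rs / 2 * (1 + (exp (- (2 * kappa * Rs)) - 1) / (2 * kappa * Rs))
  * / (1 - sqrt 3 * kappa * Rs / tanh (sqrt 3 * kappa * Rs)).

Definition J_streaming (Rs kappa B r : R) : R :=
  idsa_C Rs kappa
  * (3 * kappa ^ 2 * B * Rs / sinh (sqrt 3 * kappa * Rs))
  * (sinh (sqrt 3 * kappa * r) / (sqrt 3 * kappa * r) ^ 2
     - cosh (sqrt 3 * kappa * r) / (sqrt 3 * kappa * r)).

Definition J_idsa (Rs kappa B r : R) : R :=
  J_trapped Rs kappa B r + J_streaming Rs kappa B r.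

(* Main.v *)
Require Import Defs.
From Stdlib Require Import Reals Lra.
From Coquelicot Require Import Coquelicot.
Open Scope R_scope.

(** At the centre the geometric factor [G] is 1, so the exact solution is
    [B (1 - exp (- kappa R))].  As [r] tends to 0 the streaming component
    vanishes, because [sinh y = y cosh c] for some [0 < c < y] gives
    [0 <= cosh y / y - sinh y / y^2 <= (cosh y - 1) / y], while
    [sinh (k r) / r] tends to [k] in the trapped component. *)

Lemma J_exact_0 (Rs kappa B : R) :
  J_exact Rs kappa B 0 = B * (1 - exp (- (kappa * Rs))).
Proof.
unfold J_exact; f_equal; f_equal.
rewrite (RInt_ext _ (fun _ => exp (- (kappa * Rs)))).
- rewrite RInt_const; unfold scal; simpl; unfold mult; simpl; ring.
- intros mu _; unfold hsG.
  replace (kappa * 0 * mu) with 0 by ring.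
  replace (1 - (0 / Rs) ^ 2 * (1 - mu ^ 2)) with 1 by (unfold Rdiv; ring).
  rewrite cosh_0, sqrt_1, Rmult_1_l; f_equal; ring.
Qed.

(** Since [f 0 = 0], [f r / r] is the difference quotient of [f] at 0. This turns the limits of both
    components into derivatives at 0. *)
Lemma filterlim_div_at_right_0 (f : R -> R) (l : R) :
  f 0 = 0 -> is_derive f 0 l ->
  filterlim (fun r => f r / r) (at_right 0) (locally l).
Proof.
intros f0 Hf; apply is_derive_Reals in Hf.
apply filterlim_locally; intros eps.
destruct (Hf eps (cond_pos eps)) as [d Hd].
exists d; intros r Hr Hr0.
change (Rabs (r - 0) < d) in Hr; rewrite Rminus_0_r in Hr.
change (Rabs (f r / r - l) < eps).
specialize (Hd r (Rgt_not_eq _ _ Hr0) Hr).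
now rewrite Rplus_0_l, f0, Rminus_0_r in Hd.
Qed.

Lemma cosh_ge_1 (x : R) : 1 <= cosh x.
Proof.
unfold cosh.
assert (H := exp_ineq1_le x); assert (H' := exp_ineq1_le (- x)); lra.
Qed.

Lemma sinh_mean_bounds (y : R) : 0 < y -> y <= sinh y <= y * cosh y.
Proof.
intros Hy.
destruct (MVT_cor2 sinh cosh 0 y Hy (fun c _ => derivable_pt_lim_sinh c))
  as [c [Hc [c0 cy]]].
(* The lower bound will come from [1 <= cosh c]. For the upper bound, a second mean value step on
   [[c, y]] gives [cosh c <= cosh y], because [sinh e > 0]. *)
destruct (MVT_cor2 cosh sinh c y cy (fun c _ => derivable_pt_lim_cosh c))
  as [e [He [ec ey]]].
rewrite sinh_0, !Rminus_0_r in Hc.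
assert (H1 := cosh_ge_1 c).
assert (He0 : 0 < sinh e) by (rewrite <- sinh_0; apply sinh_lt; lra).
assert (H2 : cosh c <= cosh y) by nra.
rewrite Hc; split; nra.
Qed.

(** After multiplication by [y ^ 2] the profile is [sinh y - y * cosh y], which [sinh_mean_bounds]
    places between [y - y * cosh y] and 0. *)
Lemma streaming_profile_bound (y : R) : 0 < y ->
  Rabs (sinh y / y ^ 2 - cosh y / y) <= (cosh y - 1) / y.
Proof.
intros Hy; destruct (sinh_mean_bounds y Hy) as [H1 H2].
assert (Hi : 0 < / y ^ 2) by (apply Rinv_0_lt_compat, pow_lt, Hy).
replace (sinh y / y ^ 2 - cosh y / y) with ((sinh y - y * cosh y) * / y ^ 2)
  by (field; lra).
replace ((cosh y - 1) / y) with ((y * cosh y - y) * / y ^ 2) by (field; lra).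
apply Rabs_le; split; nra.
Qed.

Lemma streaming_profile_lim (k : R) : 0 < k ->
  filterlim (fun r => sinh (k * r) / (k * r) ^ 2 - cosh (k * r) / (k * r))
    (at_right 0) (locally 0).
Proof.
intros Hk; apply filterlim_locally; intros eps.
(* The majorant at [y = k * r], written as a difference quotient of [(cosh (k * r) - 1) / k], whose
   derivative at 0 is [sinh 0 = 0]. *)
assert (Hd : filterlim (fun r => ((cosh (k * r) - 1) / k) / r)
               (at_right 0) (locally 0)).
{ apply filterlim_div_at_right_0.
  - rewrite Rmult_0_r, cosh_0; unfold Rdiv; ring.
  - unfold cosh; auto_derive; [easy|].
    rewrite Rmult_0_r, Ropp_0, exp_0; field; lra. }
apply (proj1 (filterlim_locally _ _)) with (eps := eps) in Hd.
destruct Hd as [d Hd]; exists d; intros r Hr Hr0; specialize (Hd r Hr Hr0).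
change (Rabs ((cosh (k * r) - 1) / k / r - 0) < eps) in Hd.
change (Rabs (sinh (k * r) / (k * r) ^ 2 - cosh (k * r) / (k * r) - 0) < eps).
rewrite Rminus_0_r in *.
apply Rle_lt_trans with (2 := Hd).
apply Rle_trans with (2 := Rle_abs _).
replace ((cosh (k * r) - 1) / k / r) with ((cosh (k * r) - 1) / (k * r))
  by (field; lra).
apply streaming_profile_bound; nra.
Qed.

Lemma J_trapped_lim (Rs kappa B : R) :
  filterlim (J_trapped Rs kappa B) (at_right 0)
    (locally (B * (1 - Rs / sinh (sqrt 3 * kappa * Rs) * (sqrt 3 * kappa)))).
Proof.
set (s := sinh (sqrt 3 * kappa * Rs)).
(* Moving [/ r] next to [sinh] isolates the quotient that tends to [sqrt 3 * kappa]; the rest is an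
   affine map of it. *)
apply filterlim_ext with
  (fun r => B * (1 - Rs / s * (sinh (sqrt 3 * kappa * r) / r))).
{ intros r; unfold J_trapped; fold s; unfold Rdiv; ring. }
apply (filterlim_comp _ _ _ (fun r => sinh (sqrt 3 * kappa * r) / r)
  (fun z => B * (1 - Rs / s * z)) _ (locally (sqrt 3 * kappa))).
- apply filterlim_div_at_right_0.
  + now rewrite Rmult_0_r, sinh_0.
  + unfold sinh; auto_derive; [easy|].
    rewrite Rmult_0_r, Ropp_0, exp_0; field.
- apply (ex_derive_continuous (fun z => B * (1 - Rs / s * z))).
  now auto_derive.
Qed.

Lemma J_streaming_lim (Rs kappa B : R) : 0 < kappa ->
  filterlim (J_streaming Rs kappa B) (at_right 0) (locally 0).
Proof.
intros Hk.
set (c := idsa_C Rs kappa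
  * (3 * kappa ^ 2 * B * Rs / sinh (sqrt 3 * kappa * Rs))).
(* The prefactor [c] does not depend on [r], so only the profile has to vanish. *)
replace (locally 0) with (locally (c * 0)) by now rewrite Rmult_0_r.
apply (filterlim_comp _ _ _
  (fun r => sinh (sqrt 3 * kappa * r) / (sqrt 3 * kappa * r) ^ 2
            - cosh (sqrt 3 * kappa * r) / (sqrt 3 * kappa * r))
  (fun z => c * z) _ (locally 0)).
- apply streaming_profile_lim, Rmult_lt_0_compat; [apply sqrt_lt_R0; lra|easy].
- apply (ex_derive_continuous (fun z => c * z)); now auto_derive.
Qed.

Theorem proposition7 (Rs kappa B : R)
    (hRs : 0 < Rs) (hkappa : 0 < kappa) (hB : 0 < B) :
  exists J_idsa_0 : R,
    filterlim (J_idsa Rs kappa B) (at_right 0) (locally J_idsa_0) /\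
    (J_exact Rs kappa B 0 - J_idsa_0) / J_exact Rs kappa B 0 =
      (sqrt 3 * kappa * Rs / sinh (sqrt 3 * kappa * Rs) - exp (- (kappa * Rs)))
      / (1 - exp (- (kappa * Rs))).
Proof.
(* The sum of the trapped and streaming limits, with [+ 0] kept so that it matches [Rplus] below. *)
exists (B * (1 - Rs / sinh (sqrt 3 * kappa * Rs) * (sqrt 3 * kappa)) + 0).
split.
- eapply filterlim_comp_2 with (h := Rplus).
  + apply J_trapped_lim.
  + now apply J_streaming_lim.
  + apply (filterlim_plus (K := R_AbsRing) (V := R_NormedModule)).
- rewrite J_exact_0.
  (* These two inequalities, with [hB], make the denominators nonzero; [B] then cancels. *)
  assert (He : exp (- (kappa * Rs)) < 1).
  { rewrite <- exp_0; apply exp_increasing; nra. }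
  assert (Hs : 0 < sinh (sqrt 3 * kappa * Rs)).
  { rewrite <- sinh_0; apply sinh_lt.
    repeat apply Rmult_lt_0_compat; try easy; apply sqrt_lt_R0; lra. }
  field; repeat split; lra.
Qed.
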